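(* Let $\Omega\subseteq\mathbb{R}^n$ be open and let $F$ and $F_m$ ($m\in\mathbb{N}$) be functions in $C^0\big(\Omega\times\mathbb{R}\times\mathbb{R}^n\times\mathbb{S}(n)\big)$ such that $F_m\to F$ locally uniformly as $m\to\infty$. Suppose that $(u_m)_{m=1}^\infty\subseteq C^0(\Omega)$ and that, for each $m$, $u_m$ is a viscosity solution (respectively subsolution, respectively supersolution) on $\Omega$ of $$F_m\big(\cdot,u_m,Du_m,D^2u_m\big)=0 .$$ If $u_m\to u$ locally uniformly on $\Omega$ as $m\to\infty$ for some $u\in C^0(\Omega)$, then $u$ is a viscosity solution (respectively subsolution, respectively supersolution) on $\Omega$ of $$F\big(\cdot,u,Du,D^2u\big)=0 .$$
   Context: $\mathbb{S}(n)$ is the space of real symmetric $n\times n$ matrices, and $X:z\otimes z=\sum_{i,j}X_{ij}z_iz_j$. For $u:\Omega\to\mathbb{R}$ and $x\in\Omega$, the super-jet $\mathcal{J}^{2,+}u(x)$ is the set of all $(p,X)\in\mathbb{R}^n\times\mathbb{S}(n)$ such that $u(x+z)\le u(x)+p\cdot z+\frac12X:z\otimes z+o(|z|^2)$ as $z\to0$; the sub-jet $\mathcal{J}^{2,-}u(x)$ is defined in the same way with $\le$ replaced by $\ge$. A function $u\in C^0(\Omega)$ is a viscosity subsolution of $F(\cdot,u,Du,D^2u)=0$ on $\Omega$ if $F(x,u(x),p,X)\ge0$ for all $x\in\Omega$ and $(p,X)\in\mathcal{J}^{2,+}u(x)$; a viscosity supersolution if $F(x,u(x),p,X)\le0$ for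 all $x\in\Omega$ and $(p,X)\in\mathcal{J}^{2,-}u(x)$; and a viscosity solution if it is both. *)

(* Defs.v *)
(* R^n is 'rV[R]_n; a function on a set A is a total function of which only
   the values on A matter. *)
From mathcomp Require Import all_boot all_order all_algebra.
From mathcomp Require Import all_classical all_reals all_analysis.

Set Implicit Arguments.
Unset Strict Implicit.
Unset Printing Implicit Defensive.

Import Order.TTheory GRing.Theory Num.Theory.
Import numFieldNormedType.Exports.

Local Open Scope classical_set_scope.
Local Open Scope ring_scope.

Definition locally_uniform_cvg (R : realType) (T : topologicalType)
    (A : set T) (f_ : nat -> T -> R) (f : T -> R) : Prop :=
  forall x, A x ->
    exists2 U : set T, nbhs x U & {uniform U `&` A, f_ @ \oo --> f}.

Section Jets.
Context {R : realType} {n : nat}.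
Implicit Types (u : 'rV[R]_n -> R) (x z p : 'rV[R]_n) (X : 'M[R]_n).

Definition dotv p z : R := \sum_i p ord0 i * z ord0 i.

(* The library norm on 'rV_n is the sup norm. *)
Definition enorm z : R := Num.sqrt (dotv z z).

Definition quadf X z : R := \sum_i \sum_j X i j * z ord0 i * z ord0 j.

Definition symm : set 'M[R]_n := [set X | X^T = X].

Definition taylor2 u x (p : 'rV[R]_n) X z : R :=
  u x + dotv p z + 2^-1 * quadf X z.

(* For x in an open set, [z near 0] only involves values of u on that set. *)
Definition superjet u x : set ('rV[R]_n * 'M[R]_n) :=
  [set pX | symm pX.2 /\
    exists2 w : 'rV[R]_n -> R,
      w =o_ (nbhs (0 : 'rV[R]_n)) (fun z => enorm z ^+ 2) &
      \forall z \near (0 : 'rV[R]_n),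
        u (x + z) <= taylor2 u x pX.1 pX.2 z + w z].

Definition subjet u x : set ('rV[R]_n * 'M[R]_n) :=
  [set pX | symm pX.2 /\
    exists2 w : 'rV[R]_n -> R,
      w =o_ (nbhs (0 : 'rV[R]_n)) (fun z => enorm z ^+ 2) &
      \forall z \near (0 : 'rV[R]_n),
        u (x + z) >= taylor2 u x pX.1 pX.2 z + w z].

End Jets.

Section Viscosity.
Context {R : realType} {n : nat}.
Implicit Types (Omega : set 'rV[R]_n) (u : 'rV[R]_n -> R).
Implicit Types (F : 'rV[R]_n * R * 'rV[R]_n * 'M[R]_n -> R).

(* Omega x R x R^n x S(n) *)
Definition jet_domain Omega : set ('rV[R]_n * R * 'rV[R]_n * 'M[R]_n) :=
  [set a | Omega a.1.1.1 /\ symm a.2].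

Definition viscosity_subsolution Omega F u : Prop :=
  {within Omega, continuous u} /\
  forall x p X, Omega x -> superjet u x (p, X) -> 0 <= F (x, u x, p, X).

Definition viscosity_supersolution Omega F u : Prop :=
  {within Omega, continuous u} /\
  forall x p X, Omega x -> subjet u x (p, X) -> F (x, u x, p, X) <= 0.

Definition viscosity_solution Omega F u : Prop :=
  viscosity_subsolution Omega F u /\ viscosity_supersolution Omega F u.

End Viscosity.

(* Main.v *)
Require Import Defs.
From mathcomp Require Import all_boot all_order all_algebra.
From mathcomp Require Import all_classical all_reals all_analysis.
From mathcomp Require Import ring lra.

(** The theorem rests on the stability of jets: if [u_ m] tends to [u] locally
    uniformly and [(p, X)] is in the superjet of [u] at [x], then for all large
    [m] there are a point [y] and a superjet [(q, Y)] of [u_ m] at [y] such that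
    [(y, u_ m y, q, Y)] is as close as desired to [(x, u x, p, X)]
    ([superjet_stability]). Indeed the quadratic polynomial given by the jet,
    with its matrix enlarged to [X + e%:M], touches [u] strictly from above at
    [x]; since [u_ m] is uniformly close to [u] on a small closed ball around
    [x], the difference between [u_ m] and this polynomial has a maximum in the
    interior of the ball, and there the polynomial touches [u_ m] from above, up
    to a constant. Its gradient and Hessian at that point form the sought jet.

    The equation passes to the limit along such jets because locally uniform
    convergence of [F_ m] to the continuous [F] controls [F_ m] on a whole
    neighbourhood of [(x, u x, p, X)] ([locally_uniform_cvg_near]): if
    [F (x, u x, p, X) < 0], then [F_ m (y, u_ m y, q, Y) < 0] at a superjet of
    [u_ m], which contradicts that [u_ m] is a subsolution. Supersolutions are
    dealt with by changing [u] into [- u] ([superjetN]). *)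

Set Implicit Arguments.
Unset Strict Implicit.
Unset Printing Implicit Defensive.

Import Order.TTheory GRing.Theory Num.Theory.
Import numFieldNormedType.Exports.

Local Open Scope classical_set_scope.
Local Open Scope ring_scope.

(** * Quadratic polynomials on row vectors *)

Section QuadraticPolynomials.
Context {R : realType} {n : nat}.
Implicit Types (p z h : 'rV[R]_n) (X : 'M[R]_n).

Definition quad_poly p X z : R := dotv p z + 2^-1 * quadf X z.

Lemma dotvE p z : dotv p z = (p *m z^T) ord0 ord0.
Proof. by rewrite !mxE; apply: eq_bigr => i _; rewrite mxE. Qed.

Lemma quadfE X z : quadf X z = (z *m X *m z^T) ord0 ord0.
Proof.
rewrite !mxE /quadf exchange_big /=; apply: eq_bigr => j _.
rewrite !mxE mulr_suml; apply: eq_bigr => i _.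
by rewrite [X i j * _]mulrC.
Qed.

Lemma quadfD_scalar X (e : R) z :
  quadf (X + e%:M) z = quadf X z + e * dotv z z.
Proof.
by rewrite !quadfE dotvE mulmxDr mulmxDl mul_mx_scalar -scalemxAl !mxE.
Qed.

Lemma dotvDl p q z : dotv (p + q) z = dotv p z + dotv q z.
Proof. by rewrite !dotvE mulmxDl mxE. Qed.

Lemma dotvDr p z h : dotv p (z + h) = dotv p z + dotv p h.
Proof. by rewrite !dotvE linearD mulmxDr mxE. Qed.

Lemma dotvN p z : dotv (- p) z = - dotv p z.
Proof. by rewrite !dotvE mulNmx mxE. Qed.

Lemma quadfN X z : quadf (- X) z = - quadf X z.
Proof. by rewrite !quadfE mulmxN mulNmx mxE. Qed.

(** The second-order Taylor formula of a quadratic form is exact; symmetry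
    of [X] merges the two cross terms into the gradient [z *m X]. *)
Lemma quadfD X z h : symm X ->
  quadf X (z + h) = quadf X z + 2 * dotv (z *m X) h + quadf X h.
Proof.
move=> symX; rewrite !quadfE dotvE linearD !mulmxDl !mulmxDr.
have -> : h *m X *m z^T = (z *m X *m h^T)^T.
  by rewrite !trmx_mul trmxK symX mulmxA.
rewrite !mxE; ring.
Qed.

Lemma dotv_ge0 z : 0 <= dotv z z.
Proof. by apply: sumr_ge0 => i _; rewrite -expr2 sqr_ge0. Qed.

Lemma sqr_enorm z : enorm z ^+ 2 = dotv z z.
Proof. by rewrite sqr_sqrtr// dotv_ge0. Qed.

(** Jets are measured with the Euclidean norm while neighbourhoods of [0] are
    balls for the sup norm: through this inequality, a gap quadratic in the
    former is also one in the latter. *)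
Lemma sqr_norm_le_dotv z : `|z| ^+ 2 <= dotv z z.
Proof.
have [->|] := eqVneq `|z| 0; first by rewrite expr0n dotv_ge0.
move=> /mx_norm_neq0[[i j] /= zij]; rewrite /Num.norm/= zij ord1.
rewrite real_normK ?num_real// /dotv (bigD1 j)//= -expr2 lerDl.
by apply: sumr_ge0 => k _; rewrite -expr2 sqr_ge0.
Qed.

End QuadraticPolynomials.

(** * Continuity of matrix expressions and translations *)

Section MatrixConvergence.
Context {R : realType}.

(** Neighbourhoods of a matrix are products of neighbourhoods of its entries,
    of which there are finitely many. *)
Lemma cvg_mx (T : Type) (F : set_system T) {FF : Filter F} m n
    (f : T -> 'M[R]_(m, n)) (M : 'M[R]_(m, n)) :
  (forall i j, (fun t => f t i j) @ F --> M i j) -> f @ F --> M.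
Proof.
move=> fM A [P MP PA]; apply: (@filterS _ F _ _ _ _ _) => [t|].
  exact: (PA (f t)).
apply: filter_forall => i; apply: filter_forall => j.
exact: (fM i j _ (MP i j)).
Qed.

Lemma cvg_sum (T : Type) (F : set_system T) {FF : Filter F} (I : finType)
    (f : I -> T -> R) (a : I -> R) :
  (forall i, f i @ F --> a i) ->
  (fun t => \sum_i f i t) @ F --> \sum_i a i.
Proof. by move=> fa; apply: cvg_big => //; exact: add_continuous. Qed.

Lemma continuous_mulmxr m n p (X : 'M[R]_(n, p)) :
  continuous (fun z : 'M[R]_(m, n) => z *m X).
Proof.
move=> z; apply: (@cvg_mx _ (nbhs z) _) => i j; rewrite mxE.
under eq_cvg do rewrite mxE.
apply: (@cvg_sum _ (nbhs z) _) => k; apply: cvgM; last exact: cvg_cst.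
exact: coord_continuous.
Qed.

Lemma continuous_dotv n (p : 'rV[R]_n) : continuous (dotv p).
Proof.
move=> z; apply: (@cvg_sum _ (nbhs z) _) => k.
by apply: cvgM; [exact: cvg_cst|exact: coord_continuous].
Qed.

Lemma continuous_quadf n (X : 'M[R]_n) : continuous (quadf X).
Proof.
move=> z; apply: (@cvg_sum _ (nbhs z) _) => i.
apply: (@cvg_sum _ (nbhs z) _) => j.
apply: cvgM; last exact: coord_continuous.
by apply: cvgM; [exact: cvg_cst|exact: coord_continuous].
Qed.

End MatrixConvergence.

Section Translation.
Context {R : numFieldType} {V : normedModType R}.

Lemma continuous_translation (a : V) : continuous (fun h : V => a + h).
Proof. by move=> h; apply: cvgD; [exact: cvg_cst|exact: cvg_id]. Qed.

Lemma cvg_translate (T : Type) (F : set_system T) {FF : Filter F}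
    (f : T -> V) (a : V) :
  f @ F --> (0 : V) -> a + f t @[t --> F] --> a.
Proof.
by move=> f0; rewrite -[X in _ --> X]addr0; apply: cvgD => //; exact: cvg_cst.
Qed.

Lemma cvg_translation0 (a : V) : a + h @[h --> (0 : V)] --> a.
Proof. by rewrite -[X in _ --> X]addr0; exact: continuous_translation. Qed.

End Translation.

(** * Locally uniform convergence *)

Section UniformConvergence.
Context {R : realType}.

Lemma uniform_cvg_near (T : choiceType) (A : set T) (f_ : nat -> T -> R)
    (f : T -> R) (e : R) : 0 < e -> {uniform A, f_ @ \oo --> f} ->
  \forall m \near \oo, forall y, A y -> `|f y - f_ m y| < e.
Proof.
move=> e0 cvgf.
apply: (cvgf [set g | forall y, A y -> `|f y - g y| < e]).
apply/uniform_nbhs; exists [set ab | ball ab.1 e ab.2]; split.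
  exact: (@entourage_ball _ _ (PosNum e0)).
by move=> h hA y /hA.
Qed.

(** Locally uniform convergence to a continuous function is continuous
    convergence: near [a] and for large [m], [f_ m b] is close to [f a]. This
    is the form in which one passes to the limit in [F_ m] along jets of [u_ m]
    that only tend to a jet of [u]. *)
Lemma locally_uniform_cvg_near (T : topologicalType) (A : set T)
    (f_ : nat -> T -> R) (f : T -> R) (a : T) (e : R) :
  {within A, continuous f} -> locally_uniform_cvg A f_ f -> A a -> 0 < e ->
  exists2 W, nbhs a W & \forall m \near \oo,
    forall b, W b -> A b -> `|f a - f_ m b| < e.
Proof.
move=> /subspace_continuousP cf cvgf Aa e0.
have e20 : 0 < e / 2 by rewrite divr_gt0.
have [U aU /(uniform_cvg_near e20) Uf] := cvgf a Aa.
have /cvgrPdist_lt /(_ _ e20) fa := cf a Aa.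
exists (U `&` [set b | A b -> `|f a - f b| < e / 2]); first exact: filterI.
apply: filterS Uf => m Uf b [Ub fab] Ab.
rewrite (le_lt_trans (ler_distD (f b) _ _))// [ltRHS]splitr.
by rewrite ltrD// ?fab// Uf.
Qed.

End UniformConvergence.

(** * Stability of jets under locally uniform convergence *)

Section JetStability.
Context {R : realType} {n : nat}.
Implicit Types (Omega : set 'rV[R]_n) (u v : 'rV[R]_n -> R).
Implicit Types (x z p q : 'rV[R]_n) (X Y : 'M[R]_n).

(** Since a quadratic polynomial equals its Taylor expansion at any point, one
    that touches [v] from above, up to a constant, provides an element of the
    superjet with no remainder. *)
Lemma superjet_local_max v x z p X : symm X ->
  (\forall z' \near z,
      v (x + z') - quad_poly p X z' <= v (x + z) - quad_poly p X z) ->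
  superjet v (x + z) (p + z *m X, X).
Proof.
move=> symX vmax; split=> //; exists (fun=> 0).
  by apply/eqoP => e e0; near=> h; rewrite normr0 mulr_ge0// ltW.
have : \forall h \near (0 : 'rV[R]_n),
    v (x + (z + h)) - quad_poly p X (z + h) <= v (x + z) - quad_poly p X z.
  exact: cvg_translation0 vmax.
apply: filterS => h; rewrite /taylor2 /quad_poly addrA /=.
rewrite dotvDl dotvDr quadfD// addr0; lra.
Unshelve. all: by end_near. Qed.

(** Enlarging the matrix by [e%:M] adds [e / 2 * |z|^2] to the polynomial.
    Half of it absorbs the remainder [o(|z|^2)] of the jet, the other half
    makes the touching at [0] strict, quantitatively. *)
Lemma superjet_strict_max u x p X (e : R) : 0 < e ->
  superjet u x (p, X) ->
  \forall z \near (0 : 'rV[R]_n),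
    u (x + z) - quad_poly p (X + e%:M) z <= u x - e / 4 * `|z| ^+ 2.
Proof.
move=> e0 [/= _ [w /eqoP wo uw]].
have e40 : 0 < e / 4 by rewrite divr_gt0.
near=> z.
have wz : w z <= e / 4 * dotv z z.
  rewrite (le_trans (ler_norm _))//.
  rewrite -sqr_enorm -[leRHS]/(e / 4 * (enorm z ^+ 2)).
  rewrite -[X in _ * X]ger0_norm ?sqr_ge0//.
  by near: z; exact: wo.
have uz : u (x + z) <= taylor2 u x p X z + w z by near: z.
have := ler_wpM2l (ltW e40) (sqr_norm_le_dotv z).
move: uz; rewrite /taylor2 /quad_poly quadfD_scalar; lra.
Unshelve. all: by end_near. Qed.

Lemma cvg_perturbed_jet (T : Type) (F : set_system T) {FF : Filter F}
    (z_ : T -> 'rV[R]_n) (t_ e_ : T -> R) x (s : R) p X :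
  z_ @ F --> (0 : 'rV[R]_n) -> t_ @ F --> s -> e_ @ F --> (0 : R) ->
  (x + z_ a, t_ a, p + z_ a *m (X + (e_ a)%:M), X + (e_ a)%:M) @[a --> F]
    --> (x, s, p, X).
Proof.
move=> z0 ts e0.
have zX : z_ a *m X @[a --> F] --> (0 : 'rV[R]_n).
  rewrite -(mul0mx 1 X).
  exact: (cvg_comp _ (fun z => z *m X) z0 (@continuous_mulmxr _ _ _ _ X _)).
have ez : e_ a *: z_ a @[a --> F] --> (0 : 'rV[R]_n).
  by rewrite -(scale0r (0 : 'rV[R]_n)); exact: cvgZ.
have eI : (e_ a)%:M @[a --> F] --> (0 : 'M[R]_n).
  under eq_cvg do rewrite -scalemx1.
  by rewrite -(scale0r 1%:M); apply: cvgZ => //; exact: cvg_cst.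
have xz : x + z_ a @[a --> F] --> x.
  exact: cvg_translate.
apply: (@cvg_pair _ _ _ F (nbhs (x, s, p)) (nbhs X)); last first.
  exact: cvg_translate.
apply: (@cvg_pair _ _ _ F (nbhs (x, s)) (nbhs p)).
  exact: (@cvg_pair _ _ _ F (nbhs x) (nbhs s)).
have zY : z_ a *m (X + (e_ a)%:M) @[a --> F] --> (0 : 'rV[R]_n).
  under eq_cvg do rewrite mulmxDr mul_mx_scalar.
  by rewrite -(addr0 (0 : 'rV[R]_n)); exact: cvgD.
exact: cvg_translate.
Qed.

(** The jets produced in [superjet_stability] all have this form, so that
    entering a given neighbourhood amounts to three scalar smallness
    conditions. *)
Lemma nbhs_perturbed_jet x (s : R) p X (W : set _) :
  nbhs (x, s, p, X) W ->
  exists2 rho : R, 0 < rho & forall z (t e : R),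
    `|z| < rho -> `|t - s| < rho -> `|e| < rho ->
    W (x + z, t, p + z *m (X + e%:M), X + e%:M).
Proof.
move=> Wa.
have : nbhs ((0, s, 0) : 'rV[R]_n * R * R)
    [set a | W (x + a.1.1, a.1.2, p + a.1.1 *m (X + a.2%:M), X + a.2%:M)].
  pose F := nbhs ((0, s, 0) : 'rV[R]_n * R * R).
  have FF : Filter F by exact: nbhs_filter.
  refine (@cvg_perturbed_jet _ F FF (fun a => a.1.1) (fun a => a.1.2) snd
    x s p X _ _ _ W Wa); last exact: cvg_snd.
    by apply: (cvg_comp fst fst); exact: cvg_fst.
  by apply: (cvg_comp fst snd); [exact: cvg_fst|exact: cvg_snd].
move=> /nbhs_ballP[rho /= rho0 rhoW].
exists rho => // z t e zr tr er; apply: (rhoW (z, t, e)).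
split; [split|] => /=.
- by rewrite -ball_normE /= sub0r normrN.
- by rewrite -ball_normE /= distrC.
- by rewrite -ball_normE /= sub0r normrN.
Qed.

(** By [superjet_strict_max], [u (x + z)] minus the
    polynomial of matrix [Y := X + e%:M] has a strict maximum at [z = 0], with
    a gap of [e / 4 * |z|^2]. Compactness gives a maximum point [z0] on the
    closed ball of radius [r] for the same expression with [u_ m]. Once
    [u_ m] is uniformly [k]-close to [u] on that ball, comparing the values at
    [0] and [z0] yields [e / 4 * |z0|^2 < 2 * k <= e / 4 * r^2], so that [z0]
    is interior and [superjet_local_max] applies at [x + z0]. *)
Lemma superjet_stability Omega u (u_ : nat -> 'rV[R]_n -> R) x p X W :
  open Omega -> {within Omega, continuous u} ->
  (forall m, {within Omega, continuous (u_ m)}) ->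
  locally_uniform_cvg Omega u_ u ->
  Omega x -> superjet u x (p, X) -> nbhs (x, u x, p, X) W ->
  \forall m \near \oo, exists y q Y,
    [/\ Omega y, superjet (u_ m) y (q, Y) & W (y, u_ m y, q, Y)].
Proof.
move=> oO; rewrite continuous_open_subspace// => cu cu_ cvgu Ox jet.
move=> /nbhs_perturbed_jet[rho rho0 rhoW].
pose e := rho / 2; have e0 : 0 < e by rewrite divr_gt0.
have symY : symm (X + e%:M).
  by case: jet => /= symX _; rewrite /symm/= linearD/= tr_scalar_mx symX.
have [U xU cvgU] := cvgu x Ox.
have xz0 : x + z @[z --> (0 : 'rV[R]_n)] --> x by exact: cvg_translation0.
have : \forall z \near (0 : 'rV[R]_n),
  [/\ u (x + z) - quad_poly p (X + e%:M) z <= u x - e / 4 * `|z| ^+ 2,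
      Omega (x + z), U (x + z), `|u x - u (x + z)| < rho / 2 & `|z| < rho].
  near=> z; split; near: z.
  - exact: superjet_strict_max.
  - by apply: xz0; apply: open_nbhs_nbhs.
  - exact: xz0.
  - have cux : {for x, continuous u} by apply: cu; rewrite inE.
    have /cvgrPdist_lt := cvg_comp _ _ xz0 cux.
    by apply; rewrite divr_gt0.
  - by apply: (cvgr0_norm_lt (fun z : 'rV[R]_n => z)) => //; exact: cvg_id.
move=> /nbhs_ballP[r1 /= r10 r1P].
pose r := r1 / 2; have r0 : 0 < r by rewrite divr_gt0.
have rP z : `|z| <= r ->
  [/\ u (x + z) - quad_poly p (X + e%:M) z <= u x - e / 4 * `|z| ^+ 2,
      Omega (x + z), U (x + z), `|u x - u (x + z)| < rho / 2 & `|z| < rho].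
  move=> zr; apply: r1P; rewrite -ball_normE /= sub0r normrN.
  by rewrite (le_lt_trans zr)// ltr_pdivrMr// ltr_pMr// ltr1n.
(* The first bound keeps [u_ m (x + z0)] close to [u x], the second one is
   what forces the maximum point into the interior of the ball. *)
pose k := Num.min (rho / 2) (e * r ^+ 2 / 8).
have k0 : 0 < k by rewrite lt_min !divr_gt0// mulr_gt0// exprn_gt0.
apply: filterS (uniform_cvg_near k0 cvgU) => m um.
have {}um z : `|z| <= r -> `|u (x + z) - u_ m (x + z)| < k.
  by move=> /rP[_ Oz Uz _ _]; exact: um.
pose K := [set z : 'rV[R]_n | `|z| <= r].
have K0 : K 0 by rewrite /K/= normr0 ltW.
have cK : compact K.
  apply: bounded_closed_compact.
    exists r; split; first exact: num_real.
    by move=> M rM z /le_trans; apply; exact: ltW.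
  rewrite (_ : K = closed_ball 0 r); first exact: closed_ball_closed.
  by rewrite closed_ballE//; apply/seteqP; split => z;
    rewrite /closed_ball_/= sub0r normrN.
have [|z0 /set_mem z0K z0max] := @compact_EVT_max _ R
  (fun z => u_ m (x + z) - quad_poly p (X + e%:M) z) K (ex_intro _ 0 K0) cK.
  apply: continuous_in_subspaceT => z /set_mem /rP[_ Oz _ _ _].
  have cum : {for x + z, continuous (u_ m)}.
    by have := cu_ m; rewrite continuous_open_subspace//; apply; rewrite inE.
  have cumx := continuous_comp (@continuous_translation _ _ x z) cum.
  apply: continuousB; first exact: cumx.
  apply: continuousD; first exact: continuous_dotv.
  by apply: continuousM; [exact: cst_continuous|exact: continuous_quadf].
have [uz0 Oz0 _ uxz0 z0rho] := rP _ z0K.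
have z0r : `|z0| < r.
  have := z0max 0 (mem_set K0).
  have := um _ z0K; have := um _ K0.
  have kle : k <= e * r ^+ 2 / 8 by rewrite ge_min lexx orbT.
  rewrite !ltr_norml addr0 => /andP[_ um0] /andP[umz _] m0.
  have quad_poly0 : quad_poly p (X + e%:M) 0 = 0.
    by rewrite /quad_poly quadfE dotvE trmx0 !mulmx0 !mxE mulr0 addr0.
  rewrite -(ltr_pXn2r (n := 2)) ?nnegrE ?(ltW r0)//.
  rewrite -(ltr_pM2l e0); move: m0; rewrite quad_poly0; lra.
exists (x + z0), (p + z0 *m (X + e%:M)), (X + e%:M); split => //.
  apply: superjet_local_max => //.
  have : \forall z \near z0, `|z| < r.
    have /cvgr_lt := @norm_continuous _ _ z0; exact.
  by apply: filterS => z /ltW zr; apply: z0max; rewrite inE.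
apply: rhoW => //.
  have kle : k <= rho / 2 by rewrite ge_min lexx.
  move: (um _ z0K) uxz0; rewrite !ltr_norml => /andP[? ?] /andP[? ?].
  by apply/andP; split; lra.
by rewrite gtr0_norm// ltr_pdivrMr// ltr_pMr// ltr1n.
Unshelve. all: by end_near. Qed.

(** Negation exchanges the two kinds of jets, which transfers
    [superjet_stability] to subjets. *)
Lemma superjetN u x p X :
  superjet (fun y => - u y) x (- p, - X) <-> subjet u x (p, X).
Proof.
have symN : symm (- X) <-> symm X.
  by rewrite /symm/= linearN /=; split => [/oppr_inj|->].
have oN (w : 'rV[R]_n -> R) :
    w =o_ (nbhs (0 : 'rV[R]_n)) (fun z => enorm z ^+ 2) ->
    (fun z => - w z) =o_ (nbhs (0 : 'rV[R]_n)) (fun z => enorm z ^+ 2).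
  move=> /eqoP wo; apply/eqoP => e e0.
  by apply: filterS (wo e e0) => z; rewrite normrN.
split=> -[/= /symN symX [w /oN wo uw]]; split=> //;
  exists (fun z => - w z) => //;
  apply: filterS uw => z; rewrite /taylor2 /= dotvN quadfN; lra.
Qed.

Lemma subjet_stability Omega u (u_ : nat -> 'rV[R]_n -> R) x p X W :
  open Omega -> {within Omega, continuous u} ->
  (forall m, {within Omega, continuous (u_ m)}) ->
  locally_uniform_cvg Omega u_ u ->
  Omega x -> subjet u x (p, X) -> nbhs (x, u x, p, X) W ->
  \forall m \near \oo, exists y q Y,
    [/\ Omega y, subjet (u_ m) y (q, Y) & W (y, u_ m y, q, Y)].
Proof.
move=> oO cu cu_ cvgu Ox /superjetN jet Wa.
pose opp (a : 'rV[R]_n * R * 'rV[R]_n * 'M[R]_n) :=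
  (a.1.1.1, - a.1.1.2, - a.1.2, - a.2).
have oppW : nbhs (x, - u x, - p, - X) (opp @^-1` W).
  have /nbhs_ballP[r /= r0 rW] := Wa; apply/nbhs_ballP; exists r => //.
  move=> [[[y t] q] Y] [[[/= xy ut] pq] XY]; apply: rW.
  by split; [split; [split|]|] => //=; rewrite -ball_normE /= -normrN opprD;
    [move: ut|move: pq|move: XY]; rewrite -ball_normE /= opprK.
have cN v : {within Omega, continuous v} ->
    {within Omega, continuous (fun y => - v y)}.
  by move=> cv y; apply: cvgN; exact: cv.
have cvgN : locally_uniform_cvg Omega (fun m y => - u_ m y) (fun y => - u y).
  move=> y Oy; have [U yU Uu] := cvgu y Oy; exists U => //.
  move=> P /uniform_nbhs[E []]; rewrite -entourage_ballE.
  move=> -[e /= e0 eE] EP.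
  apply: filterS (uniform_cvg_near e0 Uu) => m um; apply: EP => y' /um.
  by move=> um'; apply: eE; rewrite /= -ball_normE /= -opprD normrN.
have := superjet_stability oO (cN _ cu) (fun m => cN _ (cu_ m)) cvgN Ox jet
  oppW.
apply: filterS => m [y [q [Y [Oy jetY WY]]]].
exists y, (- q), (- Y); split => //.
  by apply/superjetN; rewrite !opprK.
by move: WY; rewrite /= /opp /= opprK.
Qed.

End JetStability.

(** * Limits of viscosity sub- and supersolutions *)

Section ViscosityLimits.
Context {R : realType} {n : nat} {Omega : set 'rV[R]_n}.
Context {F : 'rV[R]_n * R * 'rV[R]_n * 'M[R]_n -> R}.
Context {F_ : nat -> 'rV[R]_n * R * 'rV[R]_n * 'M[R]_n -> R}.
Context {u : 'rV[R]_n -> R} {u_ : nat -> 'rV[R]_n -> R}.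
Context (open_Omega : open Omega).
Context (cont_F : {within jet_domain Omega, continuous F}).
Context (cvg_F : locally_uniform_cvg (jet_domain Omega) F_ F).
Context (cont_u : {within Omega, continuous u}).
Context (cvg_u : locally_uniform_cvg Omega u_ u).

(** If [F] were negative at a jet of [u], then by [locally_uniform_cvg_near]
    [F_ m] would be negative for large [m] on a whole neighbourhood of it,
    whereas by [superjet_stability] that neighbourhood contains a jet of
    [u_ m]. *)
Lemma viscosity_subsolution_lim :
  (forall m, viscosity_subsolution Omega (F_ m) (u_ m)) ->
  viscosity_subsolution Omega F u.
Proof.
move=> sub; split=> // x p X Ox jet; rewrite leNgt; apply/negP => F0.
have dom : jet_domain Omega (x, u x, p, X) by split=> //; case: jet.
have e0 : 0 < - F (x, u x, p, X) by rewrite oppr_gt0.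
have [W Wa FW] := locally_uniform_cvg_near cont_F cvg_F dom e0.
have cu_ m : {within Omega, continuous (u_ m)} by case: (sub m).
have jets := superjet_stability open_Omega cont_u cu_ cvg_u Ox jet Wa.
have [m [Fm [y [q [Y [Oy jetY WY]]]]]] := filter_ex (filterI FW jets).
have := Fm _ WY (conj Oy jetY.1); have := (sub m).2 y q Y Oy jetY.
by rewrite ltr_norml => Fge0 /andP[]; lra.
Qed.

Lemma viscosity_supersolution_lim :
  (forall m, viscosity_supersolution Omega (F_ m) (u_ m)) ->
  viscosity_supersolution Omega F u.
Proof.
move=> sup; split=> // x p X Ox jet; rewrite leNgt; apply/negP => F0.
have dom : jet_domain Omega (x, u x, p, X) by split=> //; case: jet.
have [W Wa FW] := locally_uniform_cvg_near cont_F cvg_F dom F0.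
have cu_ m : {within Omega, continuous (u_ m)} by case: (sup m).
have jets := subjet_stability open_Omega cont_u cu_ cvg_u Ox jet Wa.
have [m [Fm [y [q [Y [Oy jetY WY]]]]]] := filter_ex (filterI FW jets).
have := Fm _ WY (conj Oy jetY.1); have := (sup m).2 y q Y Oy jetY.
by rewrite ltr_norml => Fle0 /andP[]; lra.
Qed.

End ViscosityLimits.

Theorem theorem2 (R : realType) (n : nat) (Omega : set 'rV[R]_n)
    (F : 'rV[R]_n * R * 'rV[R]_n * 'M[R]_n -> R)
    (F_ : nat -> 'rV[R]_n * R * 'rV[R]_n * 'M[R]_n -> R)
    (u : 'rV[R]_n -> R) (u_ : nat -> 'rV[R]_n -> R)
    (open_Omega : open Omega)
    (cont_F : {within jet_domain Omega, continuous F})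
    (cont_F_ : forall m, {within jet_domain Omega, continuous (F_ m)})
    (cvg_F : locally_uniform_cvg (jet_domain Omega) F_ F)
    (cont_u_ : forall m, {within Omega, continuous (u_ m)})
    (cont_u : {within Omega, continuous u})
    (cvg_u : locally_uniform_cvg Omega u_ u) :
  [/\ (forall m, viscosity_solution Omega (F_ m) (u_ m)) ->
        viscosity_solution Omega F u,
      (forall m, viscosity_subsolution Omega (F_ m) (u_ m)) ->
        viscosity_subsolution Omega F u &
      (forall m, viscosity_supersolution Omega (F_ m) (u_ m)) ->
        viscosity_supersolution Omega F u].
Proof.
have sublim := viscosity_subsolution_lim open_Omega cont_F cvg_F cont_u cvg_u.
have suplim := viscosity_supersolution_lim open_Omega cont_F cvg_F cont_u cvg_u.
by split=> // sol; split; [apply: sublim|apply: suplim] => m; case: (sol m).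
Qed.
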